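(* Consider the MIMO radar model described in the context, with $P$ targets at spatial frequencies $\boldsymbol\omega=[\omega_1,\dots,\omega_P]^\top$, complex amplitudes $\alpha_1,\dots,\alpha_P$, noise power $\sigma_{\mathrm R}^2$, and a receive array that is a half-wavelength uniform linear array with $N_{\mathrm R}$ elements. Let $\mathbf C_{\boldsymbol\omega}$ denote the Cramér–Rao bound (CRB) matrix associated with $\boldsymbol\omega$, i.e., $$\mathbf C_{\boldsymbol\omega}=\frac{\sigma_{\mathrm R}^2}{2}\,\mathbf F_{\boldsymbol\omega}^{-1},$$ where, using the block matrix inversion lemma, $$\mathbf F_{\boldsymbol\omega}=\mathrm{Re}(\mathbf F_{11})-\widetilde{\mathbf F}_{12}\,\widetilde{\mathbf F}_{22}^{-1}\,\widetilde{\mathbf F}_{12}^\top,\qquad \widetilde{\mathbf F}_{12}=[\mathrm{Re}(\mathbf F_{12}),\,-\mathrm{Im}(\mathbf F_{12})],\qquad \widetilde{\mathbf F}_{22}=\begin{bmatrix}\mathrm{Re}(\mathbf F_{22}) & -\mathrm{Im}(\mathbf F_{22})\\ -\mathrm{Im}^\top(\mathbf F_{22}) & \mathrm{Re}(\mathbf F_{22})\end{bmatrix},$$ with $\mathbf F_{11},\mathbf F_{12},\mathbf F_{22}$ defined in the context. As $N_{\mathrm R}$ increases, the $p$th diagonal element of $\mathbf C_{\boldsymbol\omega}$, denoted $\mathbf C_{\boldsymbol\omega}(p,p)$, approaches $$\mathbf C_{\boldsymbol\omega}(p,p)=\frac{\sigma_{\mathrm R}^2}{2|\alpha_p|^2}\left[\frac1{12}N_{\mathrm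 R}^3\,b_p+N_{\mathrm R}\left(\ddot b_p-|\dot b_p|^2 b_p^{-1}\right)\right]^{-1},$$ where $$b_p=\mathbf a_{p,\mathrm T}^\dagger\mathbf R_{\mathbf X}^*\mathbf a_{p,\mathrm T},\qquad \dot b_p=\mathbf a_{p,\mathrm T}^\dagger\mathbf R_{\mathbf X}^*\dot{\mathbf a}_{p,\mathrm T},\qquad \ddot b_p=\dot{\mathbf a}_{p,\mathrm T}^\dagger\mathbf R_{\mathbf X}^*\dot{\mathbf a}_{p,\mathrm T}.$$ Moreover, this last (asymptotic) expression for $\mathbf C_{\boldsymbol\omega}(p,p)$ is upper bounded by $$\mathbf C_{\boldsymbol\omega}(p,p)\le\frac{6\,\sigma_{\mathrm R}^2}{|\alpha_p|^2N_{\mathrm R}^3\,b_p}.$$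
   Context: Notation: $(\cdot)^\top$, $(\cdot)^*$, $(\cdot)^\dagger$ denote transpose, complex conjugate, and conjugate transpose; $\odot$ is the Hadamard (entrywise) product; $\mathrm j=\sqrt{-1}$; $\mathrm{Re}(\cdot)$ and $\mathrm{Im}(\cdot)$ are taken entrywise; $\mathrm{Im}^\top(\mathbf A)=(\mathrm{Im}(\mathbf A))^\top$ and $\mathrm{Re}^\top(\mathbf A)=(\mathrm{Re}(\mathbf A))^\top$. Signal model: a MIMO system with $N_{\mathrm T}$ transmit and $N_{\mathrm R}$ receive antennas, both arrays linear, transmits the waveform matrix $\mathbf X\in\mathbb C^{N_{\mathrm T}\times L}$ ($L$ is the code length). $P$ targets are present at directions $\theta_1,\dots,\theta_P$, with spatial frequencies $\omega_p=\pi\sin(\theta_p)$ and complex amplitudes $\alpha_p$. Under the far-field and narrowband assumption the received signal is $$\mathbf Y_{\mathrm R}=\mathbf A_{\mathrm R}\mathbf B\mathbf A_{\mathrm T}^\top\mathbf X+\mathbf N_{\mathrm R}\in\mathbb C^{N_{\mathrm R}\times L},$$ where the columns of $\mathbf N_{\mathrm R}$ are i.i.d. circularly symmetric complex Gaussian with zero mean and covariance $\sigma_{\mathrm R}^2\mathbf I_{N_{\mathrm R}}$. Here $\mathbf a_{p,\mathrm R}=\mathbf a_{\mathrm R}(\omega_p)\in\mathbb C^{N_{\mathrm R}}$ and $\mathbf a_{p,\mathrm T}=\mathbf a_{\mathrm T}(\omega_p)\in\mathbb C^{N_{\mathrm T}}$ are the receive and transmit array steering vectors at $\omega_p$; $\mathbf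 A_{\mathrm R}=[\mathbf a_{1,\mathrm R},\dots,\mathbf a_{P,\mathrm R}]$, $\mathbf A_{\mathrm T}=[\mathbf a_{1,\mathrm T},\dots,\mathbf a_{P,\mathrm T}]$; $\mathbf B=\mathrm{Diag}(\boldsymbol\alpha)$ with $\boldsymbol\alpha=[\alpha_1,\dots,\alpha_P]^\top$. The receive array is a standard uniform linear array with half-wavelength spacing, so $\mathbf a_{\mathrm R}(\omega)=[1,e^{\mathrm j\omega},\dots,e^{\mathrm j(N_{\mathrm R}-1)\omega}]^\top$. The matrices $\dot{\mathbf A}_{\mathrm R}$, $\dot{\mathbf A}_{\mathrm T}$ have $p$th columns $\dot{\mathbf a}_{p,\mathrm R}=\partial\mathbf a_{\mathrm R}(\omega_p)/\partial\omega_p$ and $\dot{\mathbf a}_{p,\mathrm T}=\partial\mathbf a_{\mathrm T}(\omega_p)/\partial\omega_p$. Let $\mathbf R_{\mathbf X}=\mathbf X\mathbf X^\dagger$. Define $$\begin{aligned}\mathbf F_{11}=\;&(\dot{\mathbf A}_{\mathrm R}^\dagger\dot{\mathbf A}_{\mathrm R})\odot(\mathbf B^*\mathbf A_{\mathrm T}^\dagger\mathbf R_{\mathbf X}^*\mathbf A_{\mathrm T}\mathbf B)+(\dot{\mathbf A}_{\mathrm R}^\dagger\mathbf A_{\mathrm R})\odot(\mathbf B^*\mathbf A_{\mathrm T}^\dagger\mathbf R_{\mathbf X}^*\dot{\mathbf A}_{\mathrm T}\mathbf B)\\&+(\mathbf A_{\mathrm R}^\dagger\dot{\mathbf A}_{\mathrm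 R})\odot(\mathbf B^*\dot{\mathbf A}_{\mathrm T}^\dagger\mathbf R_{\mathbf X}^*\mathbf A_{\mathrm T}\mathbf B)+(\mathbf A_{\mathrm R}^\dagger\mathbf A_{\mathrm R})\odot(\mathbf B^*\dot{\mathbf A}_{\mathrm T}^\dagger\mathbf R_{\mathbf X}^*\dot{\mathbf A}_{\mathrm T}\mathbf B),\end{aligned}$$ $$\mathbf F_{12}=(\dot{\mathbf A}_{\mathrm R}^\dagger\mathbf A_{\mathrm R})\odot(\mathbf B^*\mathbf A_{\mathrm T}^\dagger\mathbf R_{\mathbf X}^*\mathbf A_{\mathrm T})+(\mathbf A_{\mathrm R}^\dagger\mathbf A_{\mathrm R})\odot(\mathbf B^*\dot{\mathbf A}_{\mathrm T}^\dagger\mathbf R_{\mathbf X}^*\mathbf A_{\mathrm T}),$$ $$\mathbf F_{22}=(\mathbf A_{\mathrm R}^\dagger\mathbf A_{\mathrm R})\odot(\mathbf A_{\mathrm T}^\dagger\mathbf R_{\mathbf X}^*\mathbf A_{\mathrm T}).$$ The Fisher information matrix for $[\boldsymbol\omega^\top,\mathrm{Re}(\boldsymbol\alpha^\top),\mathrm{Im}(\boldsymbol\alpha^\top)]^\top$ is $$\mathbf F=\frac{2}{\sigma_{\mathrm R}^2}\begin{bmatrix}\mathrm{Re}(\mathbf F_{11})&\mathrm{Re}(\mathbf F_{12})&-\mathrm{Im}(\mathbf F_{12})\\ \mathrm{Re}^\top(\mathbf F_{12})&\mathrm{Re}(\mathbf F_{22})&-\mathrm{Im}(\mathbf F_{22})\\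 -\mathrm{Im}^\top(\mathbf F_{12})&-\mathrm{Im}^\top(\mathbf F_{22})&\mathrm{Re}(\mathbf F_{22})\end{bmatrix},$$ the full CRB matrix is $\mathbf F^{-1}$, and $\mathbf C_{\boldsymbol\omega}$ is its block associated with $\boldsymbol\omega$. The asymptotic expression is the one obtained under the condition $N_{\mathrm R}\gg1$, using the large-$N_{\mathrm R}$ approximations $\mathbf A_{\mathrm R}^\dagger\mathbf A_{\mathrm R}\approx N_{\mathrm R}\mathbf I_P$, $\mathbf A_{\mathrm R}^\dagger\dot{\mathbf A}_{\mathrm R}\approx\frac12\mathrm jN_{\mathrm R}^2\mathbf I_P$, $\dot{\mathbf A}_{\mathrm R}^\dagger\dot{\mathbf A}_{\mathrm R}\approx\frac13N_{\mathrm R}^3\mathbf I_P$. As in the source, the symbol $\mathbf C_{\boldsymbol\omega}(p,p)$ is used both for the exact diagonal element and for the asymptotic expression it approaches. *)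

(* Defs.v *)
From HB Require Import structures.
From mathcomp Require Import all_boot all_order all_algebra.
From mathcomp Require Import sesquilinear spectral.
From mathcomp Require Import all_classical all_reals all_analysis.
From mathcomp Require Import complex.

Set Implicit Arguments.
Unset Strict Implicit.
Unset Printing Implicit Defensive.

Import Order.TTheory GRing.Theory Num.Theory.
Import numFieldNormedType.Exports.
Import ComplexField.Normc.

Local Open Scope ring_scope.
Local Open Scope complex_scope.
Local Open Scope sesquilinear_scope.

Notation "A ⊙ B" := (map2_mx *%R A B) (at level 40, left associativity).
Notation mxconj := (map_mx Num.conj).

Section ComplexCalculus.
Variable R : realType.

Definition expj (t : R) : R[i] := cos t +i* sin t.

Definition derivablec (f : R -> R[i]) (w : R) : Prop :=
  derivable (fun t => complex.Re (f t)) w 1 /\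
  derivable (fun t => complex.Im (f t)) w 1.

(* R[i] carries no normed R-module structure in the library, so the derivative
   with respect to a real variable is taken on real and imaginary parts. *)
Definition derivec (f : R -> R[i]) (w : R) : R[i] :=
  (fun t => complex.Re (f t))^`()%classic w +i*
  (fun t => complex.Im (f t))^`()%classic w.

Definition derivecv n (a : R -> 'cV[R[i]]_n) (w : R) : 'cV[R[i]]_n :=
  \col_k derivec (fun t => a t k 0) w.

Definition Remx m n (A : 'M[R[i]]_(m, n)) : 'M[R]_(m, n) :=
  map_mx (@complex.Re R) A.
Definition Immx m n (A : 'M[R[i]]_(m, n)) : 'M[R]_(m, n) :=
  map_mx (@complex.Im R) A.

End ComplexCalculus.

Section Radar.
Variables (R : realType) (P NT L : nat).
Local Notation C := R[i].
Variables (X : 'M[C]_(NT, L)) (aT : R -> 'cV[C]_NT).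
Variables (theta : 'I_P -> R) (alpha : 'cV[C]_P) (sigma : R).

Definition omega (p : 'I_P) : R := pi * sin (theta p).

(* Half-wavelength uniform linear array with N elements. *)
Definition aR (N : nat) (w : R) : 'cV[C]_N := \col_k expj (k%:R * w).

Definition steering n (a : R -> 'cV[C]_n) : 'M[C]_(n, P) :=
  \matrix_(k, p) a (omega p) k 0.

Definition AR (N : nat) : 'M[C]_(N, P) := steering (aR N).
Definition dAR (N : nat) : 'M[C]_(N, P) := steering (derivecv (aR N)).
Definition AT : 'M[C]_(NT, P) := steering aT.
Definition dAT : 'M[C]_(NT, P) := steering (derivecv aT).

Definition B : 'M[C]_P := diag_mx alpha^T.
Definition RX : 'M[C]_NT := X *m X ^t*.

(* The receive array enters the Fisher matrix only through the four products
   dAR^t* dAR, dAR^t* AR, AR^t* dAR and AR^t* AR; they are bundled so that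
   the same formulas apply to the exact products and to their large-N
   approximations. *)
Record gram := Gram {
  Gdd : 'M[C]_P; Gda : 'M[C]_P; Gad : 'M[C]_P; Gaa : 'M[C]_P }.

Definition exact_gram (N : nat) : gram := {|
  Gdd := (dAR N) ^t* *m dAR N;
  Gda := (dAR N) ^t* *m AR N;
  Gad := (AR N) ^t* *m dAR N;
  Gaa := (AR N) ^t* *m AR N |}.

Definition asym_gram (N : nat) : gram := {|
  Gdd := (N%:R ^+ 3 / 3)%:M;
  Gda := (- ('i%C * N%:R ^+ 2 / 2))%:M;
  Gad := ('i%C * N%:R ^+ 2 / 2)%:M;
  Gaa := (N%:R)%:M |}.

Definition F11 (g : gram) : 'M[C]_P :=
  Gdd g ⊙ (mxconj B *m AT ^t* *m mxconj RX *m AT *m B)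
  + Gda g ⊙ (mxconj B *m AT ^t* *m mxconj RX *m dAT *m B)
  + Gad g ⊙ (mxconj B *m dAT ^t* *m mxconj RX *m AT *m B)
  + Gaa g ⊙ (mxconj B *m dAT ^t* *m mxconj RX *m dAT *m B).

Definition F12 (g : gram) : 'M[C]_P :=
  Gda g ⊙ (mxconj B *m AT ^t* *m mxconj RX *m AT)
  + Gaa g ⊙ (mxconj B *m dAT ^t* *m mxconj RX *m AT).

Definition F22 (g : gram) : 'M[C]_P :=
  Gaa g ⊙ (AT ^t* *m mxconj RX *m AT).

Definition F12t (g : gram) : 'M[R]_(P, P + P) :=
  row_mx (Remx (F12 g)) (- Immx (F12 g)).

Definition F22t (g : gram) : 'M[R]_(P + P) :=
  block_mx (Remx (F22 g)) (- Immx (F22 g))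
           (- (Immx (F22 g))^T) (Remx (F22 g)).

Definition Fomega (g : gram) : 'M[R]_P :=
  Remx (F11 g) - F12t g *m invmx (F22t g) *m (F12t g)^T.

(* Fisher information for (omega, Re alpha, Im alpha). *)
Definition FIM (g : gram) : 'M[R]_(P + (P + P)) :=
  (2 / sigma ^+ 2) *:
  block_mx
    (Remx (F11 g)) (row_mx (Remx (F12 g)) (- Immx (F12 g)))
    (col_mx (Remx (F12 g))^T (- (Immx (F12 g))^T))
    (block_mx (Remx (F22 g)) (- Immx (F22 g))
              (- (Immx (F22 g))^T) (Remx (F22 g))).

Definition CRB_omega (g : gram) : 'M[R]_P := ulsubmx (invmx (FIM g)).

Definition bform (u v : 'cV[C]_NT) : C := (u ^t* *m mxconj RX *m v) 0 0.

Lemma RX_conj_tr : RX ^t* = RX.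
Proof.
rewrite /RX trmx_mul map_mxM /=; congr (_ *m _).
by apply/matrixP=> i j; rewrite !mxE conjCK.
Qed.

(* bform is Hermitian, so taking real parts in b and bdd loses nothing. *)
Lemma bform_diag_real (u : 'cV[C]_NT) :
  (complex.Re (bform u u))%:C = bform u u.
Proof.
suff h : (bform u u)^* = bform u u.
  have := h; case: (bform u u) => x y [] /eqP.
  by rewrite eq_sym -addr_eq0 -mulr2n mulrn_eq0 /= => /eqP ->.
have E (M : 'M[C]_1) : (M 0 0)^* = (M ^t*) 0 0 by rewrite !mxE.
rewrite /bform E; congr (fun_of_matrix _ 0 0).
have := RX_conj_tr; move: RX => S hS.
rewrite !trmx_mul !map_mxM /= mulmxA; congr (_ *m _ *m _).
  by rewrite -[in RHS]hS; apply/matrixP=> i j; rewrite !mxE.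
by apply/matrixP=> i j; rewrite !mxE conjCK.
Qed.

Definition b (p : 'I_P) : R := complex.Re (bform (aT (omega p)) (aT (omega p))).
Definition bd (p : 'I_P) : C := bform (aT (omega p)) (derivecv aT (omega p)).
Definition bdd (p : 'I_P) : R :=
  complex.Re (bform (derivecv aT (omega p)) (derivecv aT (omega p))).

Definition Casym (N : nat) (p : 'I_P) : R :=
  sigma ^+ 2 / (2 * normc (alpha p 0) ^+ 2) *
  (1 / 12 * N%:R ^+ 3 * b p
   + N%:R * (bdd p - normc (bd p) ^+ 2 * (b p)^-1))^-1.

End Radar.

(* Main.v *)
Require Import Defs.
From HB Require Import structures.
From mathcomp Require Import all_boot all_order all_algebra.
From mathcomp Require Import all_classical all_reals all_analysis.
From mathcomp Require Import complex.
From mathcomp Require Import ring.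

Set Implicit Arguments.
Unset Strict Implicit.
Unset Printing Implicit Defensive.

Import Order.TTheory GRing.Theory Num.Theory.
Import numFieldNormedType.Exports.
Import ComplexField.Normc.
Local Open Scope classical_set_scope.
Local Open Scope ring_scope.
Local Open Scope complex_scope.

(** Each Gram entry of the receive array is, up to a power of j, a sum
    [\sum_(k < N) k^m z^k] with [m <= 2], where [|z| = 1] and [z = 1] exactly on
    the diagonal.  Summation by parts bounds it by [2 N^m / |1 - z|] when
    [z <> 1], whereas it is equivalent to [N^(m+1) / (m+1)] when [z = 1].
    Hence F11 / N^3, F12 / N^2 and F22 / N converge to diagonal matrices.  The
    Schur complement Fomega is homogeneous of degree 3 for this scaling, so
    Fomega / N^3 converges to the diagonal matrix of the |alpha_q|^2 b_q / 12,
    and N^3 C(p, p) and N^3 Casym(p) have the same nonzero limit.  For the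
    large-N Gram products all blocks are exactly diagonal.  The upper bound is
    the Cauchy-Schwarz inequality |bd|^2 <= b bdd for the form of RX^*. *)

(** * Schur complements *)

Section SchurComplement.
Variables (K : fieldType) (m n : nat).
Variables (A : 'M[K]_m) (B : 'M[K]_(m, n)) (C : 'M[K]_(n, m)) (D : 'M[K]_n).
Hypothesis uD : D \in unitmx.

(** Clearing the upper right block with [D] leaves a unitriangular factor times a block lower
    triangular one, so the determinant is that of the Schur complement times [\det D], a unit. *)
Lemma unitmx_block_schur :
  (block_mx A B C D \in unitmx) = (A - B *m invmx D *m C \in unitmx).
Proof.
have -> : block_mx A B C D =
    block_mx 1%:M (B *m invmx D) 0 1%:M *m
    block_mx (A - B *m invmx D *m C) 0 C D.
  by rewrite mulmx_block !mul1mx !mul0mx !add0r subrK mulmxKV.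
rewrite unitmx_mul !unitmxE det_ublock det_lblock !det1 mul1r unitr1 /=.
by rewrite unitrM -[\det D \is a _]unitmxE uD andbT.
Qed.

(** Only the first block column of the identity [M *m W = 1%:M] is used: its lower half expresses
    the lower left block of [W] through the upper left one, and substitution in the upper half shows
    that the Schur complement inverts the latter. *)
Lemma ulsubmx_invmx_block : block_mx A B C D \in unitmx ->
  ulsubmx (invmx (block_mx A B C D)) = invmx (A - B *m invmx D *m C).
Proof.
move=> uM; have uS := uM; rewrite unitmx_block_schur in uS.
set W := invmx _; have := mulmxV uM; rewrite -/W.
rewrite -[in X in X -> _](submxK W) -[1%:M]submxK mulmx_block => /eq_block_mx[].
rewrite [ulsubmx 1%:M]ulsubmxEsub [dlsubmx 1%:M]dlsubmxEsub => e1 _ e3 _.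
have {e1}e1 : A *m ulsubmx W + B *m dlsubmx W = 1%:M.
  by rewrite e1; apply/matrixP=> i j; rewrite !mxE (inj_eq (@lshift_inj _ _)).
have {e3}e3 : dlsubmx W = - (invmx D *m C *m ulsubmx W).
  rewrite -(mulKmx uD (dlsubmx W)) -!mulmxA -mulmxN; congr (_ *m _).
  apply/eqP; rewrite -addr_eq0 addrC e3; apply/eqP/matrixP => i j.
  by rewrite !mxE eq_rlshift.
rewrite -[LHS](mulKmx uS); rewrite [X in invmx _ *m X](_ : _ = 1%:M) ?mulmx1 //.
by rewrite mulmxBl -e1 e3 mulmxN !mulmxA.
Qed.

End SchurComplement.

(** * Entrywise limits of matrices *)

Section MatrixLimits.
Variable R : realType.

(** Entrywise limits suffice here, since determinants and adjugates are polynomials in the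
    entries. *)
Definition cvgmx m n (u : nat -> 'M[R]_(m, n)) (l : 'M[R]_(m, n)) :=
  forall i j, (fun N => u N i j) @ \oo --> l i j.

Lemma cvg_addsum I (r : seq I) (Q : pred I) (u : I -> nat -> R) (l : I -> R) :
  (forall i, Q i -> u i @ \oo --> l i) ->
  (fun N => \sum_(i <- r | Q i) u i N) @ \oo --> \sum_(i <- r | Q i) l i.
Proof. by move=> h; apply: cvg_big => //; exact: add_continuous. Qed.

Lemma cvg_mulprod I (r : seq I) (Q : pred I) (u : I -> nat -> R) (l : I -> R) :
  (forall i, Q i -> u i @ \oo --> l i) ->
  (fun N => \prod_(i <- r | Q i) u i N) @ \oo --> \prod_(i <- r | Q i) l i.
Proof. by move=> h; apply: cvg_big => //; exact: mul_continuous. Qed.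

Lemma cvgmx_det n (u : nat -> 'M[R]_n) l :
  cvgmx u l -> (fun N => \det (u N)) @ \oo --> \det l.
Proof.
move=> h; apply: cvg_addsum => s _; apply: cvgMl_tmp.
by apply: cvg_mulprod => i _; exact: h.
Qed.

Lemma cvgmx_mul m n p (u : nat -> 'M[R]_(m, n)) (v : nat -> 'M[R]_(n, p)) l k :
  cvgmx u l -> cvgmx v k -> cvgmx (fun N => u N *m v N) (l *m k).
Proof.
move=> hu hv i j; under eq_fun do rewrite mxE; rewrite mxE.
by apply: cvg_addsum => q _; apply: cvgM; [exact: hu|exact: hv].
Qed.

Lemma cvgmx_sub m n (u v : nat -> 'M[R]_(m, n)) l k :
  cvgmx u l -> cvgmx v k -> cvgmx (fun N => u N - v N) (l - k).
Proof.
move=> hu hv i j; under eq_fun do rewrite !mxE; rewrite !mxE.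
by apply: cvgB; [exact: hu|exact: hv].
Qed.

Lemma cvgmx_opp m n (u : nat -> 'M[R]_(m, n)) l :
  cvgmx u l -> cvgmx (fun N => - u N) (- l).
Proof.
by move=> hu i j; under eq_fun do rewrite !mxE; rewrite !mxE; apply: cvgN.
Qed.

Lemma cvgmx_tr m n (u : nat -> 'M[R]_(m, n)) l :
  cvgmx u l -> cvgmx (fun N => (u N)^T) l^T.
Proof.
by move=> hu i j; under eq_fun do rewrite !mxE; rewrite !mxE; exact: hu.
Qed.

Lemma cvgmx_row m n1 n2 (u : nat -> 'M[R]_(m, n1)) (v : nat -> 'M[R]_(m, n2))
    l k : cvgmx u l -> cvgmx v k ->
  cvgmx (fun N => row_mx (u N) (v N)) (row_mx l k).
Proof.
move=> hu hv i j; under eq_fun do rewrite !mxE; rewrite !mxE.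
by case: (fintype.split j) => ?; [exact: hu|exact: hv].
Qed.

Lemma cvgmx_col m1 m2 n (u : nat -> 'M[R]_(m1, n)) (v : nat -> 'M[R]_(m2, n))
    l k : cvgmx u l -> cvgmx v k ->
  cvgmx (fun N => col_mx (u N) (v N)) (col_mx l k).
Proof.
move=> hu hv i j; under eq_fun do rewrite !mxE; rewrite !mxE.
by case: (fintype.split i) => ?; [exact: hu|exact: hv].
Qed.

Lemma cvgmx_unit n (u : nat -> 'M[R]_n) l :
  cvgmx u l -> l \in unitmx -> \forall N \near \oo, u N \in unitmx.
Proof.
move=> /cvgmx_det hu; rewrite unitmxE unitfE => dl0.
by apply: filterS (cvgr_neq0 _ hu dl0) => N; rewrite unitmxE unitfE.
Qed.

(** The inverse is the adjugate divided by the determinant, and both converge. *)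
Lemma cvgmx_inv n (u : nat -> 'M[R]_n) l :
  cvgmx u l -> l \in unitmx -> cvgmx (fun N => invmx (u N)) (invmx l).
Proof.
move=> hu ul i j.
rewrite [in X in _ --> X]/invmx ul !mxE.
(* On singular matrices [invmx] returns its argument, so the adjugate formula is available only for
   large [N]. *)
have E : {near \oo, (fun N => (\det (u N))^-1 * (\adj (u N)) i j) =1
                    (fun N => invmx (u N) i j)}.
  by apply: filterS (cvgmx_unit hu ul) => N uN; rewrite /invmx uN !mxE.
apply: cvg_trans (near_eq_cvg E) _; apply: cvgM.
  apply: cvgV; last exact: cvgmx_det.
  by move: ul; rewrite unitmxE unitfE.
under eq_fun do rewrite mxE.
rewrite /cofactor; apply: cvgMl_tmp; apply: cvgmx_det => a c.
by under eq_fun do rewrite !mxE; rewrite !mxE; exact: hu.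
Qed.

End MatrixLimits.

(** * Power sums on the unit circle *)

Section ComplexLimits.
Variable R : realType.
Implicit Types (u v : nat -> R[i]) (l k : R[i]).

(** Real and imaginary parts are kept apart because the Fisher matrix is built from them
    separately. *)
Definition cvgc u l :=
  (fun N => complex.Re (u N)) @ \oo --> complex.Re l /\
  (fun N => complex.Im (u N)) @ \oo --> complex.Im l.

Lemma ReM (x y : R[i]) : complex.Re (x * y) =
  complex.Re x * complex.Re y - complex.Im x * complex.Im y.
Proof. by case: x y => [? ?] [? ?]. Qed.

Lemma ImM (x y : R[i]) : complex.Im (x * y) =
  complex.Re x * complex.Im y + complex.Im x * complex.Re y.
Proof. by case: x y => [? ?] [? ?]. Qed.

Lemma ReD (x y : R[i]) : complex.Re (x + y) = complex.Re x + complex.Re y.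
Proof. by case: x y => [? ?] [? ?]. Qed.

Lemma ImD (x y : R[i]) : complex.Im (x + y) = complex.Im x + complex.Im y.
Proof. by case: x y => [? ?] [? ?]. Qed.

Lemma cvgc_cst l : cvgc (fun=> l) l.
Proof. by split; exact: cvg_cst. Qed.

Lemma cvgcD u v l k : cvgc u l -> cvgc v k -> cvgc (fun N => u N + v N) (l + k).
Proof.
move=> [a b] [c d]; split.
  by under eq_fun do rewrite ReD; rewrite ReD; exact: cvgD.
by under eq_fun do rewrite ImD; rewrite ImD; exact: cvgD.
Qed.

Lemma cvgcM u v l k : cvgc u l -> cvgc v k -> cvgc (fun N => u N * v N) (l * k).
Proof.
move=> [a b] [c d]; split.
  under eq_fun do rewrite ReM; rewrite ReM.
  by apply: cvgB; exact: cvgM.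
under eq_fun do rewrite ImM; rewrite ImM.
by apply: cvgD; exact: cvgM.
Qed.

Lemma cvgcX u l n : cvgc u l -> cvgc (fun N => u N ^+ n) (l ^+ n).
Proof.
move=> h; elim: n => [|n IH]; first exact: cvgc_cst.
by under eq_fun do rewrite exprS; rewrite exprS; exact: cvgcM.
Qed.

Lemma cvgc_real (x : nat -> R) (y : R) :
  x @ \oo --> y -> cvgc (fun N => (x N)%:C) y%:C.
Proof. by move=> h; split => //=; exact: cvg_cst. Qed.

Lemma ReIm_le_normc (x : R[i]) :
  `|complex.Re x| <= normc x /\ `|complex.Im x| <= normc x.
Proof.
case: x => a b /=; rewrite -!sqrtr_sqr.
by split; apply: ler_wsqrtr; rewrite ?lerDl ?lerDr ?sqr_ge0.
Qed.

Lemma cvgc_normc0 u (x : nat -> R) :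
  (forall N, normc (u N) <= x N) -> x @ \oo --> 0 -> cvgc u 0.
Proof.
move=> ux x0.
have sq (f : nat -> R) : (forall N, `|f N| <= x N) -> f @ \oo --> 0.
  move=> fx; apply: (squeeze_cvgr (f := fun N => - x N) (h := x)) => //.
    by apply: nearW => N; rewrite -ler_norml.
  by rewrite -[0]oppr0; exact: cvgN.
split; apply: sq => N; apply: le_trans (ux N); first by case: (ReIm_le_normc (u N)).
by case: (ReIm_le_normc (u N)).
Qed.

(** The normalising factor 1/N, with value 0 at [N = 0]; it is an embedded real so that its powers
    come out of [Remx] and [Immx]. *)
Definition invN (N : nat) : R[i] := (N%:R^-1)%:C.

Lemma cvg_invn : (fun N : nat => N%:R^-1 : R) @ \oo --> 0.
Proof. by rewrite -cvg_shiftS; exact: cvg_harmonic. Qed.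

Lemma cvgc_invN : cvgc invN 0.
Proof. exact/cvgc_real/cvg_invn. Qed.

Lemma near_gt0 : \forall N \near \oo, (0 < N)%N.
Proof. by exists 1%N. Qed.

Lemma natrC n : (n%:R : R[i]) = (n%:R : R)%:C.
Proof. by rewrite rmorph_nat. Qed.

Lemma cvgc_invNN : cvgc (fun N => invN N * N%:R) 1.
Proof.
have -> : (fun N => invN N * N%:R) = (fun N => (N%:R^-1 * N%:R : R)%:C).
  by apply/funext => N; rewrite natrC -rmorphM.
apply: cvgc_real.
have E : {near \oo, (fun=> 1 : R) =1 (fun N => N%:R^-1 * N%:R)}.
  by apply: filterS near_gt0 => N N0; rewrite /= mulVf ?pnatr_eq0 -?lt0n.
by apply: cvg_trans (near_eq_cvg E) _; exact: cvg_cst.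
Qed.

Definition powsum (m : nat) (z : R[i]) (N : nat) : R[i] :=
  \sum_(k < N) k%:R ^+ m * z ^+ k.

(* Summation by parts: the correction [N^m z^N] turns the left-hand side into a
   sequence whose increments telescope in norm. *)
Lemma powsum_bound m z N : normc z = 1 ->
  normc ((1 - z) * powsum m z N) <= 2 * N%:R ^+ m.
Proof.
move=> z1.
have zX n : normc (z ^+ n) = 1.
  by elim: n => [|n IH]; rewrite ?normc1 // exprS normcM z1 IH mulr1.
have nR (x : R) : 0 <= x -> normc x%:C = x.
  by move=> x0; rewrite /= expr0n addr0 sqrtr_sqr ger0_norm.
have nX n : (n%:R ^+ m : R[i]) = (n%:R ^+ m : R)%:C.
  by rewrite natrC -rmorphXn.
(* Passing from [N] to [N.+1] changes the corrected sequence by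
   [(N.+1%:R ^+ m - N%:R ^+ m) * z ^+ N.+1], whose norm is the increment of [N ^ m]. At [N = 0] only
   the correction remains, with value 1 when [m = 0]. *)
have T : normc ((1 - z) * powsum m z N + N%:R ^+ m * z ^+ N) <= N%:R ^+ m.
  elim: N => [|N IH].
    by rewrite /powsum big_ord0 mulr0 add0r expr0 mulr1 nX nR // exprn_ge0.
  rewrite /powsum big_ord_recr /= -/(powsum m z N).
  set S := powsum m z N in IH *.
  have -> : (1 - z) * (S + N%:R ^+ m * z ^+ N) + N.+1%:R ^+ m * z ^+ N.+1 =
    ((1 - z) * S + N%:R ^+ m * z ^+ N) + (N.+1%:R ^+ m - N%:R ^+ m) * z ^+ N.+1.
    by rewrite exprS; ring.
  apply: le_trans (le_normcD _ _) _; rewrite normcM zX mulr1 !nX -rmorphB nR.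
    by rewrite -!nX; apply: le_trans (lerD IH (lexx _)) _; rewrite addrC subrK.
  by rewrite subr_ge0 lerXn2r ?nnegrE ?ler0n ?ler_nat ?leqnSn.
(* Removing the correction costs a second [N ^ m], whence the factor 2. *)
have -> : (1 - z) * powsum m z N = ((1 - z) * powsum m z N + N%:R ^+ m * z ^+ N)
   + - (N%:R ^+ m * z ^+ N) by rewrite addrK.
apply: le_trans (le_normcD _ _) _; rewrite normcN normcM zX mulr1 nX nR ?exprn_ge0 //.
by rewrite -nX mulr_natl mulr2n lerD2r.
Qed.

(** The numerator grows at most like [N ^ m] while the normalisation is [N ^ m.+1], so a factor 1/N
    is left over. *)
Lemma cvgc_powsum_neq1 m z : normc z = 1 -> z != 1 ->
  cvgc (fun N => invN N ^+ m.+1 * powsum m z N) 0.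
Proof.
move=> z1 zN1.
have d0 : 0 < normc (1 - z).
  rewrite lt_neqAle eq_sym; apply/andP; split.
    by apply: contraNN zN1 => /eqP /eq0_normc /eqP; rewrite subr_eq0 eq_sym.
  by case: (1 - z) => a b /=; exact: sqrtr_ge0.
apply: (cvgc_normc0 (x := fun N => 2 / normc (1 - z) * N%:R^-1)); last first.
  by rewrite -[X in _ --> X](mulr0 (2 / normc (1 - z))); apply: cvgMl_tmp; exact: cvg_invn.
(* At [N = 0] both sides vanish, since the sum is empty and the inverse of 0 is 0. *)
move=> N; have [->|N0] := posnP N.
  by rewrite /powsum big_ord0 mulr0 normc0 invr0 mulr0.
have h0 : 0 < N%:R :> R by rewrite ltr0n.
rewrite normcM mulrAC ler_pdivlMr // -mulrA.
rewrite [normc (powsum _ _ _) * _]mulrC -normcM /invN -rmorphXn.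
rewrite [normc _%:C]/= expr0n addr0 sqrtr_sqr ger0_norm ?exprn_ge0 ?invr_ge0 ?ler0n //.
apply: le_trans (ler_wpM2l _ (powsum_bound m N z1)) _.
  by rewrite exprn_ge0 ?invr_ge0 ?ler0n.
have e : N%:R^-1 ^+ m * N%:R ^+ m = 1 :> R.
  by rewrite -exprMn mulVf ?expr1n // gt_eqF.
by rewrite exprS -mulrA [_ ^+ m * _]mulrCA e mulr1 mulrC.
Qed.

(** Closed forms of the sums of zeroth, first and second powers; a product of two differentiated
    steering vectors never brings a power above 2. *)
Lemma cvgc_powsum_eq1 m : (m <= 2)%N ->
  cvgc (fun N => invN N ^+ m.+1 * powsum m 1 N) (m.+1%:R^-1).
Proof.
have E j N : powsum j 1 N = \sum_(k < N) k%:R ^+ j.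
  by apply: eq_bigr => k _; rewrite expr1n mulr1.
have h := cvgc_invN; have e := cvgc_invNN.
case: m => [|[|[|//]]] _.
- have -> : (fun N => invN N ^+ 1 * powsum 0 1 N) = (fun N => invN N * N%:R).
    apply/funext => N; rewrite E expr1; congr (_ * _).
    by under eq_bigr do rewrite expr0; rewrite sumr_const card_ord.
  by rewrite invr1.
(* Each monomial is regrouped into factors [invN N * N%:R], which tend to 1, and leftover factors
   [invN N], which tend to 0. Given the closed form of the sum, this is a ring identity, valid also
   at [N = 0]. *)
- have -> : (fun N => invN N ^+ 2 * powsum 1 1 N) =
     (fun N => 2^-1 * ((invN N * N%:R) ^+ 2 + (-1) * (invN N * (invN N * N%:R)))).
    apply/funext => N; rewrite E.
    have : \sum_(k < N) (k%:R : R[i]) ^+ 1 = 2^-1 * (N%:R ^+ 2 - N%:R).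
      elim: N => [|N IH]; first by rewrite big_ord0 expr0n subrr mulr0.
      by rewrite big_ord_recr /= IH -[N.+1]addn1 natrD; field.
    by move=> ->; ring.
  rewrite [X in cvgc _ X](_ : _ = 2^-1 * (1 ^+ 2 + (-1) * (0 * 1))); last by ring.
  apply: cvgcM; first exact: cvgc_cst.
  apply: cvgcD; first exact: cvgcX.
  by apply: cvgcM; [exact: cvgc_cst|exact: cvgcM].
have -> : (fun N => invN N ^+ 3 * powsum 2 1 N) =
     (fun N => 6^-1 * (2 * (invN N * N%:R) ^+ 3 +
      ((-3) * (invN N * (invN N * N%:R) ^+ 2) + invN N ^+ 2 * (invN N * N%:R)))).
  apply/funext => N; rewrite E.
  have : \sum_(k < N) (k%:R : R[i]) ^+ 2 =
      6^-1 * (2 * N%:R ^+ 3 - 3 * N%:R ^+ 2 + N%:R).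
    elim: N => [|N IH]; first by rewrite big_ord0; ring.
    by rewrite big_ord_recr /= IH -[N.+1]addn1 natrD; field.
  by move=> ->; ring.
rewrite [X in cvgc _ X](_ : _ =
  6^-1 * (2 * 1 ^+ 3 + ((-3) * (0 * 1 ^+ 2) + 0 ^+ 2 * 1))); last by field.
apply: cvgcM; first exact: cvgc_cst.
apply: cvgcD; first by apply: cvgcM; [exact: cvgc_cst|exact: cvgcX].
apply: cvgcD; last by apply: cvgcM e; exact: cvgcX.
by apply: cvgcM; [exact: cvgc_cst|apply: cvgcM h _; exact: cvgcX].
Qed.

End ComplexLimits.

(** * Gram matrices of the receive array *)

Section ReceiveArray.
Variables (R : realType) (P : nat) (theta : 'I_P -> R).
Local Notation om := (omega theta).

Lemma expjD (s t : R) : expj (s + t) = expj s * expj t.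
Proof. by rewrite /expj cosD sinD; congr (_ +i* _); rewrite addrC. Qed.

Lemma expjX (n : nat) (t : R) : expj (n%:R * t) = expj t ^+ n.
Proof.
elim: n => [|n IH]; first by rewrite mul0r /expj cos0 sin0.
by rewrite exprS -IH -expjD -natr1 mulrDl mul1r addrC.
Qed.

Lemma expj_conjM (t : R) : Num.conj (expj t) * expj t = 1.
Proof.
apply/eqP; rewrite eq_complex /=; apply/andP; split; apply/eqP.
  by rewrite mulNr opprK -!expr2 cos2Dsin2.
by rewrite mulNr mulrC subrr.
Qed.

Lemma normc_conj (x : R[i]) : normc (Num.conj x) = normc x.
Proof. by case: x => a b /=; rewrite sqrrN. Qed.

Lemma normc_expj (t : R) : normc (expj t) = 1.
Proof. by rewrite /= cos2Dsin2 sqrtr1. Qed.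

Lemma derivec_expj (k : nat) (w : R) :
  derivec (fun t => expj (k%:R * t)) w = 'i%C * k%:R * expj (k%:R * w).
Proof.
have lin : is_derive w 1 (fun t : R => k%:R * t) k%:R.
  by apply: is_derive_eq; rewrite ?scaler0 ?addr0 /GRing.scale /= mulr1.
have dc : is_derive w 1 (fun t => cos (k%:R * t)) (- sin (k%:R * w) * k%:R).
  exact: (is_derive1_comp (f := cos)).
have ds : is_derive w 1 (fun t => sin (k%:R * t)) (cos (k%:R * w) * k%:R).
  exact: (is_derive1_comp (f := sin)).
rewrite /derivec /expj /= !derive1E !derive_val natrC; apply/eqP.
by rewrite eq_complex /=; apply/andP; split; apply/eqP; ring.
Qed.

(** The ratio of the element-to-element phase shifts of targets [q] and [p], conjugation being
    inversion on the unit circle. *)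
Definition phase (p q : 'I_P) : R[i] := Num.conj (expj (om p)) * expj (om q).

Lemma normc_phase p q : normc (phase p q) = 1.
Proof. by rewrite /phase normcM normc_conj !normc_expj mulr1. Qed.

Lemma phase_id p : phase p p = 1.
Proof. exact: expj_conjM. Qed.

Lemma phase_neq1 p q : expj (om p) != expj (om q) -> phase p q != 1.
Proof.
apply: contra => /eqP h; apply/eqP.
have /(congr1 (fun x => expj (om p) * x)) := h.
by rewrite /phase mulrA [expj _ * Num.conj _]mulrC expj_conjM mul1r mulr1 => ->.
Qed.

Lemma AR_entry N (k : 'I_N) p : AR theta N k p = expj (om p) ^+ k.
Proof. by rewrite !mxE expjX. Qed.

Lemma dAR_entry N (k : 'I_N) p :
  dAR theta N k p = 'i%C * k%:R * expj (om p) ^+ k.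
Proof.
rewrite !mxE -expjX -derivec_expj; congr (derivec _ _).
by apply/funext => t; rewrite mxE.
Qed.

Lemma conj_i : Num.conj ('i%C : R[i]) = - 'i%C.
Proof. by apply/eqP; rewrite eq_complex /= oppr0 !eqxx. Qed.

(** Differentiating element [k] multiplies it by ['i * k], and by [- 'i * k] after conjugation. The
    two imaginary factors multiply to 1 in [Gdd]. *)
Lemma gram_powsum N p q :
  [/\ Gdd (exact_gram theta N) p q = powsum 2 (phase p q) N,
      Gda (exact_gram theta N) p q = - 'i%C * powsum 1 (phase p q) N,
      Gad (exact_gram theta N) p q = 'i%C * powsum 1 (phase p q) N
    & Gaa (exact_gram theta N) p q = powsum 0 (phase p q) N].
Proof.
have cA (k : 'I_N) r : Num.conj (AR theta N k r) = Num.conj (expj (om r)) ^+ k.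
  by rewrite AR_entry rmorphXn.
have cdA (k : 'I_N) r :
    Num.conj (dAR theta N k r) = - 'i%C * k%:R * Num.conj (expj (om r)) ^+ k.
  rewrite dAR_entry 2!rmorphM rmorphXn rmorph_nat.
  by congr (_ * _ * _); exact: conj_i.
have i2 : ('i%C : R[i]) * 'i%C = -1 by rewrite -expr2 sqr_i.
rewrite /exact_gram /=; split; rewrite ?mulr_sumr mxE; apply: eq_bigr => k _;
  rewrite 2!mxE ?cA ?cdA ?AR_entry ?dAR_entry /phase exprMn ?expr0 ?expr1 ?mul1r;
  set x := Num.conj _ ^+ k; set y := _ ^+ k; last by [].
- transitivity (- ('i%C * 'i%C) * (k%:R ^+ 2 * (x * y)) : R[i]); first by ring.
  by rewrite i2 opprK mul1r.
- by ring.
- by ring.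
Qed.

Definition cvgcmx m n (u : nat -> 'M[R[i]]_(m, n)) (l : 'M[R[i]]_(m, n)) :=
  forall i j, cvgc (fun N => u N i j) (l i j).

Lemma cvgcmx_Re m n (u : nat -> 'M[R[i]]_(m, n)) l :
  cvgcmx u l -> cvgmx (fun N => Remx (u N)) (Remx l).
Proof.
by move=> h i j; under eq_fun do rewrite mxE; rewrite mxE; have [] := h i j.
Qed.

Lemma cvgcmx_Im m n (u : nat -> 'M[R[i]]_(m, n)) l :
  cvgcmx u l -> cvgmx (fun N => Immx (u N)) (Immx l).
Proof.
by move=> h i j; under eq_fun do rewrite mxE; rewrite mxE; have [] := h i j.
Qed.

Hypothesis omega_distinct : injective (fun q : 'I_P => expj (om q)).

(** Distinctness of the frequencies modulo 2 pi puts every off-diagonal phase in the bounded case of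
    the power sums. *)
Lemma cvgc_powsum_phase m p q : (m <= 2)%N ->
  cvgc (fun N => invN R N ^+ m.+1 * powsum m (phase p q) N)
         ((p == q)%:R / m.+1%:R).
Proof.
move=> m2; have [<-|pq] := eqVneq p q.
  by rewrite phase_id mul1r; exact: cvgc_powsum_eq1.
rewrite mul0r; apply: cvgc_powsum_neq1; first exact: normc_phase.
by apply: phase_neq1; apply: contraNneq pq => /omega_distinct ->.
Qed.

(** Rigorous form of the large-array approximations: after division by the natural power of [N], the
    coefficients 1/3, -j/2, j/2 and 1 remain on the diagonal. *)
Lemma exact_gram_cvg :
  [/\ cvgcmx (fun N => invN R N ^+ 3 *: Gdd (exact_gram theta N)) (3^-1)%:M,
      cvgcmx (fun N => invN R N ^+ 2 *: Gda (exact_gram theta N))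
        (- ('i%C / 2))%:M,
      cvgcmx (fun N => invN R N ^+ 2 *: Gad (exact_gram theta N)) ('i%C / 2)%:M
    & cvgcmx (fun N => invN R N *: Gaa (exact_gram theta N)) 1%:M].
Proof.
split=> p q; rewrite !mxE -[X in cvgc _ X]mulr_natr;
  under eq_fun do rewrite mxE.
- have E N : Gdd (exact_gram theta N) p q = powsum 2 (phase p q) N.
    by case: (gram_powsum N p q).
  under eq_fun do rewrite E.
  by rewrite mulrC; exact: cvgc_powsum_phase.
- have E N : Gda (exact_gram theta N) p q = - 'i%C * powsum 1 (phase p q) N.
    by case: (gram_powsum N p q).
  under eq_fun do rewrite E mulrCA.
  rewrite [X in cvgc _ X](_ : _ = - 'i%C * ((p == q)%:R / 2)); last by ring.
  by apply: cvgcM; [exact: cvgc_cst|exact: cvgc_powsum_phase].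
- have E N : Gad (exact_gram theta N) p q = 'i%C * powsum 1 (phase p q) N.
    by case: (gram_powsum N p q).
  under eq_fun do rewrite E mulrCA.
  rewrite [X in cvgc _ X](_ : _ = 'i%C * ((p == q)%:R / 2)); last by ring.
  by apply: cvgcM; [exact: cvgc_cst|exact: cvgc_powsum_phase].
- have E N : Gaa (exact_gram theta N) p q = powsum 0 (phase p q) N.
    by case: (gram_powsum N p q).
  under eq_fun do rewrite E.
  by have := cvgc_powsum_phase p q (isT : (0 <= 2)%N); rewrite invr1 mulr1 mul1r.
Qed.

End ReceiveArray.

(** * Block structure of the Fisher matrix *)

Section FisherBlocks.
Variables (R : realType) (P : nat).

(** [fisher_amp] and [fisher_schur] are [F22t] and [Fomega] with the blocks as free arguments, so
    that they can also be evaluated at rescaled blocks and at their limits. *)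
Definition fisher_amp (K22 : 'M[R[i]]_P) : 'M[R]_(P + P) :=
  block_mx (Remx K22) (- Immx K22) (- (Immx K22)^T) (Remx K22).

Definition fisher_schur (K11 K12 K22 : 'M[R[i]]_P) : 'M[R]_P :=
  Remx K11 - row_mx (Remx K12) (- Immx K12) *m invmx (fisher_amp K22)
             *m (row_mx (Remx K12) (- Immx K12))^T.

Lemma RemxZ (s : R) (A : 'M[R[i]]_P) : Remx (s%:C *: A) = s *: Remx A.
Proof. by apply/matrixP=> i j; rewrite !mxE ReM /= mul0r subr0. Qed.

Lemma ImmxZ (s : R) (A : 'M[R[i]]_P) : Immx (s%:C *: A) = s *: Immx A.
Proof. by apply/matrixP=> i j; rewrite !mxE ImM /= mul0r addr0. Qed.

Lemma fisher_ampZ (s : R) K22 : fisher_amp (s%:C *: K22) = s *: fisher_amp K22.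
Proof.
rewrite /fisher_amp RemxZ ImmxZ scale_block_mx !scalerN.
by rewrite [(s *: _)^T]linearZ.
Qed.

(** The correction term takes [s ^+ 2] from each outer factor and [s^-1] from the inverse, hence
    [s ^+ 3], the same degree as the first block. *)
Lemma fisher_schurZ (s : R) K11 K12 K22 : s != 0 ->
  fisher_amp K22 \in unitmx ->
  fisher_schur (s%:C ^+ 3 *: K11) (s%:C ^+ 2 *: K12) (s%:C *: K22) =
  s ^+ 3 *: fisher_schur K11 K12 K22.
Proof.
move=> s0 u; rewrite /fisher_schur -!rmorphXn fisher_ampZ !RemxZ !ImmxZ -scalerN.
rewrite -scale_row_mx linearZ /= invmxZ ?unitmxZ ?unitfE //.
rewrite -!scalemxAl -!scalemxAr -scalemxAl !scalerA scalerBr; congr (_ - _ *: _).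
by field.
Qed.

Lemma invmx_diag n (d : 'rV[R]_n) : (forall q, d 0 q != 0) ->
  diag_mx d \in unitmx /\ invmx (diag_mx d) = diag_mx (\row_q (d 0 q)^-1).
Proof.
move=> d0.
have e : diag_mx d *m diag_mx (\row_q (d 0 q)^-1) = 1%:M.
  apply/matrixP=> i j; rewrite mul_diag_mx !mxE.
  by have [->|_] := eqVneq i j; rewrite ?mulr1n ?mulr0n ?mulr0 // mulfV.
have [u _] := mulmx1_unit e.
by split => //; rewrite -[RHS](mulKmx u) e mulmx1.
Qed.

(** A real diagonal third block has no imaginary part, so the amplitude matrix is block diagonal;
    the squares of the real and imaginary parts of [f] then add up to its squared modulus. *)
Lemma fisher_diag (a f : 'rV[R[i]]_P) (d : 'rV[R]_P) :
  (forall q, d 0 q != 0) ->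
  fisher_amp (diag_mx (map_mx (real_complex R) d)) \in unitmx /\
  fisher_schur (diag_mx a) (diag_mx f) (diag_mx (map_mx (real_complex R) d)) =
  diag_mx (\row_q (complex.Re (a 0 q) - normc (f 0 q) ^+ 2 / d 0 q)).
Proof.
move=> d0; have [ud id] := invmx_diag d0.
have Re_diag (v : 'rV[R[i]]_P) : Remx (diag_mx v) = diag_mx (Remx v).
  by apply/matrixP=> i j; rewrite !mxE; case: eqP.
have Im_diag (v : 'rV[R[i]]_P) : Immx (diag_mx v) = diag_mx (Immx v).
  by apply/matrixP=> i j; rewrite !mxE; case: eqP.
have E : fisher_amp (diag_mx (map_mx (real_complex R) d)) =
    block_mx (diag_mx d) 0 0 (diag_mx d).
  rewrite /fisher_amp Re_diag Im_diag.
  have -> : Remx (map_mx (real_complex R) d) = d by apply/matrixP=> i j; rewrite !mxE.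
  have -> : Immx (map_mx (real_complex R) d) = 0 by apply/matrixP=> i j; rewrite !mxE.
  by rewrite linear0 trmx0 oppr0.
have ub : block_mx (diag_mx d) 0 0 (diag_mx d) \in unitmx.
  by rewrite unitmxE det_ublock unitrM -!unitmxE ud.
rewrite /fisher_schur E; split => //.
rewrite !Re_diag !Im_diag invmx_block_diag // id tr_row_mx mul_row_block !mulmx0.
rewrite addr0 add0r mul_row_col linearN /= !tr_diag_mx mulNmx mulmxN mulNmx opprK.
apply/matrixP=> i j; rewrite -!mulmxA !mul_diag_mx !mxE.
have [->|_] := eqVneq i j; last by rewrite !mulr0n !mulr0 addr0 subr0.
rewrite !mulr1n; case: (f 0 j) => x y /=.
rewrite sqr_sqrtr ?addr_ge0 ?sqr_ge0 //; congr (_ - _); field; exact: d0.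
Qed.

End FisherBlocks.

(** * Entries of the Fisher blocks and the Hermitian form of the transmit array *)

Section FisherMatrix.
Variables (R : realType) (P NT L : nat).
Variables (X : 'M[R[i]]_(NT, L)) (aT : R -> 'cV[R[i]]_NT).
Variables (theta : 'I_P -> R) (alpha : 'cV[R[i]]_P) (sigma : R).
Hypothesis sigma_gt0 : 0 < sigma.
Local Notation om := (omega theta).

Section Gram.
Variable g : gram R P.
Hypothesis uF22 : F22t X aT theta g \in unitmx.

Local Notation F := (block_mx (Remx (F11 X aT theta alpha g))
  (F12t X aT theta alpha g) (F12t X aT theta alpha g)^T (F22t X aT theta g)).

Lemma FIM_block : FIM X aT theta alpha sigma g = (2 / sigma ^+ 2) *: F.
Proof. by rewrite /FIM /F12t /F22t tr_row_mx linearN. Qed.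

Lemma fim_scale_neq0 : 2 / sigma ^+ 2 != 0.
Proof. by rewrite gt_eqF // divr_gt0 // exprn_gt0. Qed.

Lemma unitmx_FIM : (FIM X aT theta alpha sigma g \in unitmx) =
  (Fomega X aT theta alpha g \in unitmx).
Proof.
by rewrite FIM_block unitmxZ ?unitfE ?fim_scale_neq0 // unitmx_block_schur.
Qed.

Lemma CRB_omegaE : Fomega X aT theta alpha g \in unitmx ->
  CRB_omega X aT theta alpha sigma g =
  (sigma ^+ 2 / 2) *: invmx (Fomega X aT theta alpha g).
Proof.
move=> u; have uM := u; rewrite -unitmx_FIM FIM_block in uM.
have ulZ c (A : 'M[R]_(P + (P + P))) : ulsubmx (c *: A) = c *: ulsubmx A.
  by apply/matrixP=> i j; rewrite !mxE.
rewrite /CRB_omega FIM_block invmxZ // ulZ invf_div; congr (_ *: _).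
apply: (ulsubmx_invmx_block uF22).
by rewrite unitmxZ ?unitfE ?fim_scale_neq0 in uM.
Qed.

End Gram.

Lemma steering_form (M : 'M[R[i]]_NT) (u v : R -> 'cV[R[i]]_NT) p q :
  ((map_mx Num.conj (steering theta u)^T) *m M *m steering theta v) p q =
  (map_mx Num.conj (u (om p))^T *m M *m v (om q)) 0 0.
Proof.
rewrite !mxE; apply: eq_bigr => k _; rewrite !mxE; congr (_ * _).
by apply: eq_bigr => l _; rewrite !mxE.
Qed.

Local Notation a := (fun q => aT (om q)).
Local Notation a' := (fun q => derivecv aT (om q)).
Local Notation form := (bform X).

Lemma addmxE (U V : 'M[R[i]]_P) p q : (U + V) p q = U p q + V p q.
Proof. by rewrite mxE. Qed.

Lemma hadmxE (U V : 'M[R[i]]_P) p q : (U ⊙ V) p q = U p q * V p q.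
Proof. by rewrite mxE. Qed.

Lemma F22_entry (g : gram R P) p q :
  F22 X aT theta g p q = Gaa g p q * form (a p) (a q).
Proof. by rewrite mxE steering_form. Qed.

Lemma B_form (u v : R -> 'cV[R[i]]_NT) p q :
  (map_mx Num.conj (B alpha) *m map_mx Num.conj (steering theta u)^T
    *m map_mx Num.conj (RX X) *m steering theta v) p q =
  Num.conj (alpha p 0) * form (u (om p)) (v (om q)).
Proof.
rewrite -!mulmxA /B map_diag_mx mul_diag_mx mxE; congr (_ * _); first by rewrite !mxE.
by rewrite mulmxA steering_form.
Qed.

Lemma F12_entry (g : gram R P) p q : F12 X aT theta alpha g p q =
  Num.conj (alpha p 0) *
  (Gda g p q * form (a p) (a q) + Gaa g p q * form (a' p) (a q)).
Proof.
rewrite addmxE mulrDr; congr (_ + _); rewrite [LHS]hadmxE mulrCA; congr (_ * _).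
  exact: (B_form aT aT).
exact: (B_form (derivecv aT) aT).
Qed.

(** The diagonal matrix [B] scales columns by [alpha], its conjugate scales rows, and the middle
    products are values of the transmit form. *)
Lemma F11_entry (g : gram R P) p q : F11 X aT theta alpha g p q =
  Num.conj (alpha p 0) *
  (Gdd g p q * form (a p) (a q) + Gda g p q * form (a p) (a' q) +
   Gad g p q * form (a' p) (a q) + Gaa g p q * form (a' p) (a' q)) * alpha q 0.
Proof.
have e (G : 'M[R[i]]_P) (u v : R -> 'cV[R[i]]_NT) :
  (G ⊙ (map_mx Num.conj (B alpha) *m map_mx Num.conj (steering theta u)^T
    *m map_mx Num.conj (RX X) *m steering theta v *m B alpha)) p q =
  Num.conj (alpha p 0) * (G p q * form (u (om p)) (v (om q))) * alpha q 0.
  have mB (V : 'M[R[i]]_P) : (V *m B alpha) p q = V p q * alpha q 0.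
    by rewrite /B mul_mx_diag !mxE.
  rewrite hadmxE mB B_form.
  by rewrite mulrA [G p q * _]mulrCA.
rewrite !mulrDr !mulrDl /F11 3!addmxE; congr (_ + _ + _ + _).
- exact: (e (Gdd g) aT aT).
- exact: (e (Gda g) aT (derivecv aT)).
- exact: (e (Gad g) (derivecv aT) aT).
- exact: (e (Gaa g) (derivecv aT) (derivecv aT)).
Qed.

Lemma RX_conj_form : map_mx Num.conj (RX X) = map_mx Num.conj X *m X^T.
Proof.
rewrite /RX map_mxM /=; congr (_ *m _).
by apply/matrixP=> i j; rewrite !mxE conjCK.
Qed.

(** The conjugate of [RX] factors as [X^* X^T], so the form is the standard inner product of [X^T u]
    and [X^T v]. Hermitian symmetry and positivity follow. *)
Lemma formE (u v : 'cV[R[i]]_NT) :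
  form u v = \sum_l Num.conj ((X^T *m u) l 0) * (X^T *m v) l 0.
Proof.
rewrite /bform RX_conj_form mulmxA -mulmxA.
have -> : map_mx Num.conj u^T *m map_mx Num.conj X = map_mx Num.conj (X^T *m u)^T.
  by rewrite trmx_mul trmxK map_mxM.
by rewrite mxE; apply: eq_bigr => l _; congr (_ * _); rewrite !mxE.
Qed.

Lemma form_conj (u v : 'cV[R[i]]_NT) : Num.conj (form u v) = form v u.
Proof.
rewrite !formE rmorph_sum; apply: eq_bigr => l _.
by rewrite rmorphM /= conjCK mulrC.
Qed.

Lemma form_ge0 (u : 'cV[R[i]]_NT) : 0 <= complex.Re (form u u).
Proof.
have : 0 <= form u u.
  rewrite formE; apply: sumr_ge0 => l _; rewrite mulrC; exact: mul_conjC_ge0.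
by rewrite lecE => /andP[].
Qed.

Lemma formBZl (c d : R[i]) (u v w : 'cV[R[i]]_NT) :
  form w (c *: u - d *: v) = c * form w u - d * form w v.
Proof. by rewrite /bform mulmxBr -!scalemxAr !mxE. Qed.

(** At [w = form u u *: v - form u v *: u] the form equals [form u u] times the gap in the
    Cauchy-Schwarz inequality; it is nonnegative, and the positive factor cancels. *)
Lemma form_cauchy_schwarz (u v : 'cV[R[i]]_NT) : 0 < complex.Re (form u u) ->
  normc (form u v) ^+ 2 / complex.Re (form u u) <= complex.Re (form v v).
Proof.
move=> b0; rewrite ler_pdivrMr //; set w := form u u *: v - form u v *: u.
(* Linearity is at hand in the second argument only; the first is moved there by Hermitian
   symmetry. *)
have := form_ge0 w; rewrite {2}/w formBZl -[form w u]form_conj -[form w v]form_conj.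
rewrite /w !formBZl -[form v u]form_conj.
have := b0; rewrite -[form u u]bform_diag_real -[form v v]bform_diag_real /=.
set x := complex.Re (form u u); set y := complex.Re (form v v).
case: (form u v) => s t x0 /= h; rewrite sqr_sqrtr ?addr_ge0 ?sqr_ge0 //.
rewrite -(ler_pM2l x0) -subr_ge0; apply: le_trans h _.
by rewrite le_eqVlt; apply/orP; left; apply/eqP; ring.
Qed.

End FisherMatrix.

(** * Large arrays *)

Section LargeArray.
Variables (R : realType) (P NT L : nat).
Variables (X : 'M[R[i]]_(NT, L)) (aT : R -> 'cV[R[i]]_NT).
Variables (theta : 'I_P -> R) (alpha : 'cV[R[i]]_P) (sigma : R).
Hypothesis sigma_gt0 : 0 < sigma.
Hypothesis omega_distinct : injective (fun q : 'I_P => expj (omega theta q)).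
Hypothesis alpha_neq0 : forall q : 'I_P, alpha q 0 != 0.
Hypothesis b_neq0 : forall q : 'I_P, b X aT theta q != 0.
Local Notation om := (omega theta).
Local Notation beta := (b X aT theta).
Local Notation ex := (exact_gram theta).
Local Notation ap := (asym_gram R P).
Local Notation pow q := (normc (alpha q 0) ^+ 2).
Local Notation excess q :=
  (bdd X aT theta q - normc (bd X aT theta q) ^+ 2 * (beta q)^-1).

Lemma b_gt0 q : 0 < beta q.
Proof. by rewrite lt_neqAle eq_sym b_neq0 form_ge0. Qed.

Lemma excess_ge0 q : 0 <= excess q.
Proof. by rewrite subr_ge0; apply: form_cauchy_schwarz; exact: b_gt0. Qed.

Lemma normc_sqr (z : R[i]) :
  normc z ^+ 2 = complex.Re z ^+ 2 + complex.Im z ^+ 2.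
Proof. by case: z => x y /=; rewrite sqr_sqrtr // addr_ge0 ?sqr_ge0. Qed.

Lemma normc_sqr_gt0 (z : R[i]) : z != 0 -> 0 < normc z ^+ 2.
Proof.
move=> z0; rewrite exprn_even_gt0 //=.
by apply: contraNneq z0 => /eq0_normc ->.
Qed.

(** Here [n], [k], [l], [z], [w] stand for the array size, [b], [bdd], [alpha] and [bd]. The terms
    linear in [w] cancel between the first block and the squared modulus, and the cubic coefficient
    is 1/3 - 1/4 = 1/12. *)
Lemma diagonal_entry (n k l : R) (z w : R[i]) : n != 0 -> k != 0 ->
  complex.Re (Num.conj z * ((n ^+ 3 / 3)%:C * k%:C
    + - ('i%C * (n ^+ 2 / 2)%:C) * w + 'i%C * (n ^+ 2 / 2)%:C * Num.conj w
    + n%:C * l%:C) * z)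
  - normc (Num.conj z *
     (- ('i%C * (n ^+ 2 / 2)%:C) * k%:C + n%:C * Num.conj w)) ^+ 2 / (n * k)
  = normc z ^+ 2 * (1 / 12 * n ^+ 3 * k + n * (l - normc w ^+ 2 * k^-1)).
Proof.
move=> n0 k0; rewrite !normc_sqr; case: z w => [x y] [u v] /=.
by field; rewrite n0 k0.
Qed.

(* The constant is 1/12 = 1/3 - |j/2|^2. *)
Lemma diagonal_limit_entry (k : R) (z : R[i]) : k != 0 ->
  complex.Re (Num.conj z * ((3^-1)%:C * k%:C) * z)
  - normc (Num.conj z * (- ('i%C * (2^-1)%:C) * k%:C)) ^+ 2 / k
  = normc z ^+ 2 * (k / 12).
Proof. by move=> k0; rewrite !normc_sqr; case: z => [x y] /=; field. Qed.

(** * Limits of the rescaled exact Fisher blocks and of their Schur complement *)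

Lemma scalemxE (m n : nat) (s : R[i]) (A : 'M[R[i]]_(m, n)) p q :
  (s *: A) p q = s * A p q.
Proof. by rewrite mxE. Qed.

Lemma invcE n : (n%:R^-1 : R[i]) = (n%:R^-1 : R)%:C.
Proof. by rewrite fmorphV rmorph_nat. Qed.

Lemma cvgcmx_scale (s : nat -> R[i]) (A : nat -> 'M[R[i]]_P) l p q :
  cvgcmx (fun N => s N *: A N) l ->
  cvgc (fun N => s N * A N p q) (l p q).
Proof. by move=> h; have := h p q; under eq_fun do rewrite scalemxE. Qed.

(** In each block only the term with the most derivatives of the receive array survives. *)
Definition lim11 : 'M[R[i]]_P := diag_mx (\row_q
  (Num.conj (alpha q 0) * ((3^-1 : R)%:C * (beta q)%:C) * alpha q 0)).
Definition lim12 : 'M[R[i]]_P := diag_mx (\row_q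
  (Num.conj (alpha q 0) * (- ('i%C * (2^-1 : R)%:C) * (beta q)%:C))).
Definition lim22 : 'M[R[i]]_P :=
  diag_mx (map_mx (real_complex R) (\row_q beta q)).

Lemma diag_mxE (v : 'rV[R[i]]_P) p q : diag_mx v p q = v 0 q * (p == q)%:R.
Proof. by rewrite mxE; have [->|_] := eqVneq p q; rewrite ?mulr1 ?mulr0. Qed.

Lemma F22_cvg : cvgcmx (fun N => invN R N *: F22 X aT theta (ex N)) lim22.
Proof.
have [_ _ _ h] := exact_gram_cvg omega_distinct => p q.
under eq_fun do rewrite scalemxE F22_entry mulrA.
rewrite [X in cvgc _ X](_ : _ = 1%:M p q * bform X (aT (om p)) (aT (om q))).
  by apply: cvgcM; [exact: cvgcmx_scale h|exact: cvgc_cst].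
rewrite diag_mxE !mxE; have [->|_] := eqVneq p q; last by rewrite mulr0 mul0r.
by rewrite mulr1 mul1r /beta /= bform_diag_real.
Qed.

Lemma F12_cvg :
  cvgcmx (fun N => invN R N ^+ 2 *: F12 X aT theta alpha (ex N)) lim12.
Proof.
have [_ h1 _ h2] := exact_gram_cvg omega_distinct => p q.
(* Each Gram entry receives its own normalising power; the surplus factor [s] sends the lower-order
   term to 0. *)
have E (s c g1 g2 f1 f2 : R[i]) : s ^+ 2 * (c * (g1 * f1 + g2 * f2)) =
   c * (s ^+ 2 * g1 * f1 + s * (s * g2 * f2)) by ring.
under eq_fun do rewrite scalemxE F12_entry E.
set k0 := bform _ _ _; set k1 := bform _ _ _.
rewrite [X in cvgc _ X](_ : _ = Num.conj (alpha p 0) *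
  ((- ('i%C / 2))%:M p q * k0 + 0 * (1%:M p q * k1))).
  apply: cvgcM; first exact: cvgc_cst.
  apply: cvgcD; first by apply: cvgcM; [exact: cvgcmx_scale h1|exact: cvgc_cst].
  by apply: cvgcM (cvgc_invN R) _; apply: cvgcM; [exact: cvgcmx_scale h2|exact: cvgc_cst].
rewrite diag_mxE !mxE; rewrite -invcE /k0.
have [->|_] := eqVneq p q; last by rewrite mulr0 mul0r mulr0n !mul0r add0r mulr0.
by rewrite mulr1 mulr1n mul0r addr0 /beta /= bform_diag_real.
Qed.

Lemma F11_cvg :
  cvgcmx (fun N => invN R N ^+ 3 *: F11 X aT theta alpha (ex N)) lim11.
Proof.
have [h1 h2 h3 h4] := exact_gram_cvg omega_distinct => p q.
have E (s c d g1 g2 g3 g4 f1 f2 f3 f4 : R[i]) :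
   s ^+ 3 * (c * (g1 * f1 + g2 * f2 + g3 * f3 + g4 * f4) * d) =
   c * (s ^+ 3 * g1 * f1 + s * (s ^+ 2 * g2 * f2) + s * (s ^+ 2 * g3 * f3) +
        s ^+ 2 * (s * g4 * f4)) * d by ring.
under eq_fun do rewrite scalemxE F11_entry E.
set k0 := bform _ _ _; set k1 := bform _ _ _; set k2 := bform _ _ _.
set k3 := bform _ _ _.
rewrite [X in cvgc _ X](_ : _ = Num.conj (alpha p 0) *
  (3^-1%:M p q * k0 + 0 * ((- ('i%C / 2))%:M p q * k1)
   + 0 * (('i%C / 2)%:M p q * k2) + 0 ^+ 2 * (1%:M p q * k3)) * alpha q 0).
  apply: cvgcM (cvgc_cst _); apply: cvgcM (cvgc_cst _) _.
  have c0 := cvgc_invN R.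
  apply: cvgcD; last first.
    apply: cvgcM; first exact: cvgcX.
    by apply: cvgcM; [exact: cvgcmx_scale h4|exact: cvgc_cst].
  apply: cvgcD; last first.
    by apply: cvgcM c0 _; apply: cvgcM; [exact: cvgcmx_scale h3|exact: cvgc_cst].
  apply: cvgcD; last first.
    by apply: cvgcM c0 _; apply: cvgcM; [exact: cvgcmx_scale h2|exact: cvgc_cst].
  by apply: cvgcM; [exact: cvgcmx_scale h1|exact: cvgc_cst].
rewrite diag_mxE !mxE -invcE /k0 expr0n !mul0r !addr0.
have [->|_] := eqVneq p q; last by rewrite mulr0 mulr0n mul0r mulr0 mul0r.
by rewrite mulr1 mulr1n /beta /= bform_diag_real.
Qed.

Lemma lim_schur : fisher_amp lim22 \in unitmx /\
  fisher_schur lim11 lim12 lim22 = diag_mx (\row_q (pow q * (beta q / 12))).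
Proof.
have b0 q : (\row_q beta q) 0 q != 0 by rewrite mxE.
have [u ->] := fisher_diag
  (\row_q (Num.conj (alpha q 0) * ((3^-1 : R)%:C * (beta q)%:C) * alpha q 0))
  (\row_q (Num.conj (alpha q 0) * (- ('i%C * (2^-1 : R)%:C) * (beta q)%:C))) b0.
split => //; congr diag_mx; apply/rowP => q; rewrite !mxE.
exact: diagonal_limit_entry.
Qed.

Lemma fisher_amp_cvg :
  cvgmx (fun N => fisher_amp (invN R N *: F22 X aT theta (ex N)))
        (fisher_amp lim22).
Proof.
have r := cvgcmx_Re F22_cvg; have i := cvgcmx_Im F22_cvg.
apply: cvgmx_col; apply: cvgmx_row => //; apply: cvgmx_opp => //.
exact: cvgmx_tr.
Qed.

(** By homogeneity this is [Fomega] divided by the cube of [N] once [F22t] is invertible, but it is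
    assembled from blocks that converge. *)
Definition scaled_Fomega N := fisher_schur
  (invN R N ^+ 3 *: F11 X aT theta alpha (ex N))
  (invN R N ^+ 2 *: F12 X aT theta alpha (ex N))
  (invN R N *: F22 X aT theta (ex N)).

Lemma scaled_Fomega_cvg :
  cvgmx scaled_Fomega (diag_mx (\row_q (pow q * (beta q / 12)))).
Proof.
have [u <-] := lim_schur.
have rw : cvgmx (fun N => row_mx
     (Remx (invN R N ^+ 2 *: F12 X aT theta alpha (ex N)))
   (- Immx (invN R N ^+ 2 *: F12 X aT theta alpha (ex N))))
   (row_mx (Remx lim12) (- Immx lim12)).
  apply: cvgmx_row; first exact: (cvgcmx_Re F12_cvg).
  by apply: cvgmx_opp; exact: (cvgcmx_Im F12_cvg).
apply: cvgmx_sub; first exact: (cvgcmx_Re F11_cvg).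
apply: cvgmx_mul; last exact: cvgmx_tr.
by apply: cvgmx_mul rw _; apply: cvgmx_inv u; exact: fisher_amp_cvg.
Qed.

Lemma lim_unit : diag_mx (\row_q (pow q * (beta q / 12))) \in unitmx /\
  forall q, invmx (diag_mx (\row_q (pow q * (beta q / 12)))) q q =
            (pow q * (beta q / 12))^-1.
Proof.
have d0 q : (\row_q (pow q * (beta q / 12))) 0 q != 0.
  by rewrite mxE gt_eqF // mulr_gt0 ?normc_sqr_gt0 // divr_gt0 ?b_gt0.
have [u ->] := invmx_diag d0; split => // q.
by rewrite !mxE eqxx mulr1n.
Qed.

Lemma near_F22t_unit : \forall N \near \oo, F22t X aT theta (ex N) \in unitmx.
Proof.
have [u _] := lim_schur.
apply: filterS (filterI near_gt0 (cvgmx_unit fisher_amp_cvg u)) => N [N0].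
rewrite fisher_ampZ unitmxZ //.
by rewrite unitfE invr_eq0 pnatr_eq0 -lt0n.
Qed.

Lemma scaled_FomegaE N : (0 < N)%N -> F22t X aT theta (ex N) \in unitmx ->
  scaled_Fomega N = N%:R^-1 ^+ 3 *: Fomega X aT theta alpha (ex N).
Proof.
move=> N0 u; rewrite /scaled_Fomega /invN fisher_schurZ //.
by rewrite invr_eq0 pnatr_eq0 -lt0n.
Qed.

(** Invertibility is an open condition at the positive diagonal limit, and it is unaffected by the
    nonzero factor between the scaled and unscaled matrices. *)
Lemma near_Fomega_unit :
  \forall N \near \oo, [/\ (0 < N)%N, F22t X aT theta (ex N) \in unitmx
    & Fomega X aT theta alpha (ex N) \in unitmx].
Proof.
have [u _] := lim_unit.
have h := cvgmx_unit scaled_Fomega_cvg u.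
apply: filterS (filterI near_gt0 (filterI near_F22t_unit h)) => N [N0 [u2]].
rewrite scaled_FomegaE // unitmxZ // unitfE expf_neq0 //.
by rewrite invr_eq0 pnatr_eq0 -lt0n.
Qed.

Lemma CRB_ratio_cvg p :
  (fun N => CRB_omega X aT theta alpha sigma (ex N) p p /
            Casym X aT theta alpha sigma N p) @ \oo --> (1 : R).
Proof.
have [u up] := lim_unit.
have a0 := normc_sqr_gt0 (alpha_neq0 p); have bp := b_gt0 p.
(* The ratio after taking the cube of [N] out of the bracket in [Casym]: it turns the inverse of
   [Fomega] into that of [scaled_Fomega], and the noise power cancels. The excess term keeps a
   factor 1/N squared and disappears in the limit. *)
pose r N := pow p * invmx (scaled_Fomega N) p p *
  (beta p / 12 + N%:R^-1 * N%:R^-1 * excess p).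
have E : {near \oo, r =1 (fun N => CRB_omega X aT theta alpha sigma (ex N) p p /
            Casym X aT theta alpha sigma N p)}.
  apply: filterS near_Fomega_unit => N [N0 u2 uF].
  have n0 : N%:R != 0 :> R by rewrite pnatr_eq0 -lt0n.
  rewrite /r CRB_omegaE // scaled_FomegaE // invmxZ; last first.
    by rewrite unitmxZ // unitfE expf_neq0 // invr_eq0.
  rewrite /Casym !mxE; set w := invmx _ _ _; set e := excess p.
  have -> : 1 / 12 * N%:R ^+ 3 * beta p + N%:R * e =
      N%:R ^+ 3 * (beta p / 12 + N%:R^-1 * N%:R^-1 * e) by field.
  move: (beta p / 12 + _) => y; rewrite !invfM !invrK.
  by field; rewrite gt_eqF.
apply: cvg_trans (near_eq_cvg E) _.
have one : pow p * (pow p * (beta p / 12))^-1 * (beta p / 12 + 0 * 0 * excess p) = 1.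
  by move: (pow p) (beta p) (excess p) a0 bp => x y e x0 y0; field; rewrite !gt_eqF.
have iN := @cvg_invn R.
suff : r @ \oo --> pow p * (pow p * (beta p / 12))^-1 *
    (beta p / 12 + 0 * 0 * excess p) by rewrite one.
apply: cvgM.
  apply: cvgMl_tmp; rewrite -up; exact: (cvgmx_inv scaled_Fomega_cvg u).
apply: cvgD; first exact: cvg_cst.
by apply: cvgM; [exact: cvgM|exact: cvg_cst].
Qed.

(** * The large-array Gram products and the upper bound *)

Lemma asym_term_gt0 N q : (0 < N)%N ->
  0 < 1 / 12 * N%:R ^+ 3 * beta q + N%:R * excess q.
Proof.
move=> N0; have n0 : 0 < N%:R :> R by rewrite ltr0n.
by rewrite ltr_pwDl ?mulr_ge0 ?excess_ge0 ?ltW // !mulr_gt0 ?exprn_gt0 ?b_gt0.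
Qed.

(** All Gram products being scalar matrices, the three blocks are diagonal and the targets decouple,
    which leaves one scalar computation per target. *)
Lemma asym_Fomega N : (0 < N)%N ->
  F22t X aT theta (ap N) \in unitmx /\
  Fomega X aT theta alpha (ap N) = diag_mx (\row_q
    (pow q * (1 / 12 * N%:R ^+ 3 * beta q + N%:R * excess q))).
Proof.
move=> N0; have n0 : N%:R != 0 :> R by rewrite pnatr_eq0 -lt0n.
have d0 q : (\row_q (N%:R * beta q)) 0 q != 0 by rewrite mxE mulf_neq0.
pose nn : R := N%:R.
(* The conjugate of [bd] appears because the form with its arguments exchanged is conjugated. *)
pose v11 : 'rV[R[i]]_P := \row_q (Num.conj (alpha q 0) *
   ((nn ^+ 3 / 3)%:C * (beta q)%:C + - ('i%C * (nn ^+ 2 / 2)%:C) * bd X aT theta q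
    + 'i%C * (nn ^+ 2 / 2)%:C * Num.conj (bd X aT theta q)
    + nn%:C * (bdd X aT theta q)%:C) * alpha q 0).
pose v12 : 'rV[R[i]]_P := \row_q (Num.conj (alpha q 0) *
   (- ('i%C * (nn ^+ 2 / 2)%:C) * (beta q)%:C + nn%:C * Num.conj (bd X aT theta q))).
have c3 : (N%:R ^+ 3 / 3 : R[i]) = (nn ^+ 3 / 3)%:C.
  by rewrite /nn rmorphM rmorphXn fmorphV !rmorph_nat.
have c2 : ('i%C * N%:R ^+ 2 / 2 : R[i]) = 'i%C * (nn ^+ 2 / 2)%:C.
  by rewrite /nn rmorphM rmorphXn fmorphV !rmorph_nat -mulrA.
have c1 : (N%:R : R[i]) = nn%:C by rewrite natrC.
have [e3 e2 e2' e1] : [/\ Gdd (ap N) = ((nn ^+ 3 / 3)%:C)%:M,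
    Gda (ap N) = (- ('i%C * (nn ^+ 2 / 2)%:C))%:M,
    Gad (ap N) = ('i%C * (nn ^+ 2 / 2)%:C)%:M & Gaa (ap N) = (nn%:C)%:M].
  by rewrite /asym_gram /= c3 c2 c1.
have f11 : F11 X aT theta alpha (ap N) = diag_mx v11.
  apply/matrixP=> p q; rewrite F11_entry diag_mxE e3 e2 e2' e1 !mxE.
  have [->|_] := eqVneq p q; last by rewrite !mulr0n !mul0r !addr0 !mulr0 mul0r.
  by rewrite !mulr1n mulr1 !bform_diag_real form_conj.
have f12 : F12 X aT theta alpha (ap N) = diag_mx v12.
  apply/matrixP=> p q; rewrite F12_entry diag_mxE e2 e1 !mxE.
  have [->|_] := eqVneq p q; last by rewrite !mulr0n !mul0r !addr0 !mulr0.
  by rewrite !mulr1n mulr1 !bform_diag_real form_conj.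
have f22 : F22 X aT theta (ap N) =
    diag_mx (map_mx (real_complex R) (\row_q (N%:R * beta q))).
  apply/matrixP=> p q; rewrite F22_entry diag_mxE e1 !mxE.
  have [->|_] := eqVneq p q; last by rewrite !mulr0n !mul0r !mulr0.
  by rewrite !mulr1n mulr1 rmorphM /= bform_diag_real.
have [u s] := fisher_diag v11 v12 d0.
rewrite -f22 in u s; split; first exact: u.
rewrite -f11 -f12 in s; rewrite [LHS]s; congr diag_mx; apply/rowP => q.
by rewrite !mxE diagonal_entry.
Qed.

Lemma asym_CRB N p : (0 < N)%N ->
  FIM X aT theta alpha sigma (ap N) \in unitmx /\
  CRB_omega X aT theta alpha sigma (ap N) p p = Casym X aT theta alpha sigma N p.
Proof.
move=> N0; have [u2 e] := asym_Fomega N0.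
have d0 q : (\row_q (pow q * (1 / 12 * N%:R ^+ 3 * beta q + N%:R * excess q))) 0 q
    != 0.
  by rewrite mxE gt_eqF // mulr_gt0 ?normc_sqr_gt0 // asym_term_gt0.
have [u ei] := invmx_diag d0; rewrite -e in u ei.
split; first by rewrite unitmx_FIM.
rewrite CRB_omegaE // ei !mxE eqxx mulr1n /Casym.
by rewrite !invfM !mulrA; congr (_ * _).
Qed.

(** Dropping the nonnegative excess term from the bracket can only increase its inverse; what
    remains equals the bound, with 12/2 = 6. *)
Lemma Casym_le N p : (0 < N)%N ->
  Casym X aT theta alpha sigma N p <=
  6 * sigma ^+ 2 / (normc (alpha p 0) ^+ 2 * N%:R ^+ 3 * beta p).
Proof.
move=> N0; have n0 : 0 < N%:R :> R by rewrite ltr0n.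
have a0 := normc_sqr_gt0 (alpha_neq0 p); have bp := b_gt0 p.
have t0 : 0 < 1 / 12 * N%:R ^+ 3 * beta p by rewrite !mulr_gt0 ?exprn_gt0.
rewrite /Casym; apply: (@le_trans _ _ (sigma ^+ 2 / (2 * pow p) *
   (1 / 12 * N%:R ^+ 3 * beta p)^-1)).
  rewrite ler_wpM2l //; first by rewrite divr_ge0 ?sqr_ge0 // mulr_ge0 ?ltW.
  by rewrite lef_pV2 ?posrE ?asym_term_gt0 // lerDl mulr_ge0 ?excess_ge0 ?ltW.
rewrite le_eqVlt; apply/orP; left; apply/eqP.
by move: (pow p) a0 (beta p) bp => x x0 y y0; field; rewrite !gt_eqF.
Qed.

End LargeArray.
(** Convergence is stated for the quotient because both quantities decay like the inverse cube of
    [N], so a vanishing difference would say nothing about the leading constant. *)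
Theorem proposition1 (R : realType) (P NT L : nat)
    (X : 'M[R[i]]_(NT, L)) (aT : R -> 'cV[R[i]]_NT)
    (theta : 'I_P -> R) (alpha : 'cV[R[i]]_P) (sigma : R)
    (sigma_gt0 : 0 < sigma)
    (aT_derivable : forall (q : 'I_P) (k : 'I_NT),
       derivablec (fun t => aT t k 0) (omega theta q))
    (omega_distinct : injective (fun q : 'I_P => expj (omega theta q)))
    (alpha_neq0 : forall q : 'I_P, alpha q 0 != 0)
    (b_neq0 : forall q : 'I_P, b X aT theta q != 0)
    (p : 'I_P) :
  let ex N := exact_gram theta N in
  let ap N := asym_gram R P N in
  let F22t := F22t X aT theta in
  let Fomega := Fomega X aT theta alpha in
  let FIM := FIM X aT theta alpha sigma in
  let Comega := CRB_omega X aT theta alpha sigma in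
  let Cinf N := Casym X aT theta alpha sigma N p in
  [/\ (* nonsingularity of the Fisher matrix for large arrays *)
      (\forall N \near \oo,
         F22t (ex N) \in unitmx /\ FIM (ex N) \in unitmx),
      (* the omega-block of the full CRB matrix *)
      (forall N : nat, F22t (ex N) \in unitmx -> FIM (ex N) \in unitmx ->
         Fomega (ex N) \in unitmx /\
         Comega (ex N) = (sigma ^+ 2 / 2) *: invmx (Fomega (ex N))),
      (* asymptotics of the exact diagonal entry *)
      (fun N : nat => Comega (ex N) p p / Cinf N) @ \oo --> (1 : R),
      (* the asymptotic expression comes from the large-N Gram products *)
      (forall N : nat, (0 < N)%N ->
         [/\ F22t (ap N) \in unitmx, FIM (ap N) \in unitmx
           & Comega (ap N) p p = Cinf N])
    & (forall N : nat, (0 < N)%N ->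
         Cinf N <= 6 * sigma ^+ 2 /
           (normc (alpha p 0) ^+ 2 * N%:R ^+ 3 * b X aT theta p))].
Proof.
split.
- apply: filterS (near_Fomega_unit omega_distinct alpha_neq0 b_neq0) => N [_ u2 u].
  by split; rewrite // unitmx_FIM.
- move=> N u2 uM; have u := uM; rewrite unitmx_FIM // in u.
  by split; rewrite // CRB_omegaE.
- exact: CRB_ratio_cvg.
- move=> N N0; have [u2 _] := asym_Fomega alpha b_neq0 N0.
  have [uM e] := asym_CRB sigma_gt0 alpha_neq0 b_neq0 p N0.
  by split.
- by move=> N N0; exact: Casym_le.
Qed.
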